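(* Let $U, W, V, F, \mathcal{R}_U, \mathcal{R}_W$ satisfy assumptions (A1)--(A4) listed in the context. Let $\alpha\ge\beta>0$ and $v^\delta\in V$. Assume that for every $\lambda\in[0,1]$ there exists a unique global minimizer $(u_{\alpha,\beta}^{\delta}(\lambda), w_{\alpha,\beta}^{\delta}(\lambda))$ of the functional $$\mathcal{T}_{\alpha,\beta}(u,w,\lambda)=\|F(\lambda u+(1-\lambda)w)-v^\delta\|_V^2+\lambda\alpha\,\mathcal{R}_U(u)+(1-\lambda)\beta\,\mathcal{R}_W(w)$$ with respect to $(u,w)$, with $\lambda$ fixed (where for $\lambda=0$ only the element $w_{\alpha,\beta}^{\delta}(0)\in W$ is considered, and for $\lambda=1$ only the element $u_{\alpha,\beta}^{\delta}(1)\in U$). Then the mappings $$w_{\alpha,\beta}^{\delta}:[0,1)\to W,\quad \lambda\mapsto w_{\alpha,\beta}^{\delta}(\lambda),\qquad u_{\alpha,\beta}^{\delta}:(0,1]\to U,\quad \lambda\mapsto u_{\alpha,\beta}^{\delta}(\lambda)$$ are continuous.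
   Context: Assumptions. (A1) $V$ is a Hilbert space and $W$ is a reflexive Banach space. $U$ is a closed reflexive proper subspace of $W$, $U\subsetneq W$; the norms are denoted $\|\cdot\|_U$, $\|\cdot\|_W$, $\|\cdot\|_V$. (A2) $F:\mathcal{D}(F)\subseteq W\to V$, where $\mathcal{D}(F)$ is closed and convex and $\mathcal{D}:=\mathcal{D}(F)\cap U\neq\emptyset$. The map $F$ is strongly continuous, i.e. $w_n\rightharpoonup w$ (weakly) implies $F(w_n)\to F(w)$ (in norm). Furthermore $F$ is a $C^1$-map. (A3) $\mathcal{R}_W:W\to[0,\infty)$ is a $C^2$-map with $\mathcal{R}_W(0)=0$, $\mathcal{R}_W'(0)=0$, and there is a constant $C>0$ such that $\langle\mathcal{R}_W''(w)h,h\rangle_{W^*}\ge C\|h\|_W^2$ for all $w,h\in W$. (A4) $\mathcal{R}_U:U\to[0,\infty)$ is a $C^2$-map with $\mathcal{R}_U(u)\ge\mathcal{R}_W(u)$ for all $u\in U$, $\mathcal{R}_U(0)=0$, $\mathcal{R}_U'(0)=0$, and there is a constant $C>0$ such that $\langle\mathcal{R}_U''(u)h,h\rangle_{U^*}\ge C\|h\|_U^2$ for all $u,h\in U$. Here $\langle\cdot,\cdot\rangle_{X^*}$ denotes the duality pairing between $X^*$ and $X$. Minimization. For fixed $\lambda\in[0,1]$, $\mathcal{T}_{\alpha,\beta}(\cdot,\cdot,\lambda)$ is minimized over $(u,w)\in U\times W$ subject to $z=\lambda u+(1-\lambda)w\in\mathcal{D}(F)$. For $\lambda=0$ the functional reduces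 to $\|F(w)-v^\delta\|_V^2+\beta\mathcal{R}_W(w)$ and one minimizes over $w\in W$, $w\in\mathcal{D}(F)$; for $\lambda=1$ it reduces to $\|F(u)-v^\delta\|_V^2+\alpha\mathcal{R}_U(u)$ and one minimizes over $u\in U$, $u\in\mathcal{D}(F)$. *)

(* Defs.v *)
From HB Require Import structures.
From mathcomp Require Import all_boot all_order all_algebra.
From mathcomp Require Import sesquilinear.
From mathcomp Require Import all_classical all_reals all_analysis.

Set Implicit Arguments.
Unset Strict Implicit.
Unset Printing Implicit Defensive.

Import Order.TTheory GRing.Theory Num.Theory.
Import numFieldNormedType.Exports.
Local Open Scope classical_set_scope.
Local Open Scope ring_scope.

(** * The normed space [L(E, G)] of continuous linear maps *)

Section ContinuousLinearMaps.
Context {R : realType} (E G : normedModType R).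

Definition clin_pred : {pred E -> G} :=
  fun f => `[< linear f /\ continuous f >].

Record clin := CLin { clin_fun :> E -> G ; _ : clin_fun \in clin_pred }.

HB.instance Definition _ := [isSub of clin for clin_fun].
HB.instance Definition _ := [Choice of clin by <:].

Fact clin_linear (f : clin) : linear f.
Proof. by case: f => f /= /asboolP[]. Qed.

Fact clin_continuous (f : clin) : continuous f.
Proof. by case: f => f /= /asboolP[]. Qed.

HB.instance Definition _ (f : clin) :=
  @GRing.isLinear.Build R E G _ f (@clin_linear f).

Fact clin_submod_closed : submod_closed clin_pred.
Proof.
split=> [|a f g /asboolP[lf cf] /asboolP[lg cg]]; apply/asboolP; split.
- by move=> a x y; rewrite /= scaler0 addr0.
- exact: cst_continuous.
- move=> b x y.
  rewrite !fctE lf lg !scalerDr !scalerA [b * a]mulrC -!addrA.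
  by congr (_ + _); rewrite addrCA.
- by move=> x; apply: cvgD; [apply: cvgZl_tmp; exact: cf|exact: cg].
Qed.

HB.instance Definition _ :=
  GRing.isSubmodClosed.Build R (E -> G) clin_pred clin_submod_closed.
HB.instance Definition _ := [SubChoice_isSubLmodule of clin by <:].

Definition opnorm (f : clin) : R :=
  sup [set `|f x| | x in [set x : E | `|x| <= 1]].

Fact opnorm_has_sup (f : clin) :
  has_sup [set `|f x| | x in [set x : E | `|x| <= 1]].
Proof.
split; first by exists `|f 0|; exists 0 => //=; rewrite normr0.
have /linear_bounded_continuous/bounded_funP/(_ 1)[M fM] :=
  @clin_continuous f.
by exists M => _ [x /= x1 <-]; exact: fM.
Qed.

Fact opnorm_ub (f : clin) (x : E) : `|x| <= 1 -> `|f x| <= opnorm f.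
Proof.
by move=> x1; apply: ub_le_sup; [exact: (opnorm_has_sup f).2|exists x].
Qed.

Fact opnorm_lub (f : clin) (M : R) :
  (forall x : E, `|x| <= 1 -> `|f x| <= M) -> opnorm f <= M.
Proof.
move=> fM; apply: ge_sup; first exact: (opnorm_has_sup f).1.
by move=> _ [x /= x1 <-]; exact: fM.
Qed.

Fact opnorm_ge0 (f : clin) : 0 <= opnorm f.
Proof.
by apply: (le_trans (normr_ge0 (f 0))); apply: opnorm_ub; rewrite normr0.
Qed.

Fact clin_addE (f g : clin) (x : E) : (f + g) x = f x + g x.
Proof. by []. Qed.

Fact clin_scaleE (a : R) (f : clin) (x : E) : (a *: f) x = a *: f x.
Proof. by []. Qed.

Fact opnormD (f g : clin) : opnorm (f + g) <= opnorm f + opnorm g.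
Proof.
apply: opnorm_lub => x x1; rewrite clin_addE.
by rewrite (le_trans (ler_normD _ _))// lerD// opnorm_ub.
Qed.

Fact opnormZ_le (a : R) (f : clin) : opnorm (a *: f) <= `|a| * opnorm f.
Proof.
apply: opnorm_lub => x x1; rewrite clin_scaleE normrZ.
by rewrite ler_wpM2l// opnorm_ub.
Qed.

Fact opnormZ (a : R) (f : clin) : opnorm (a *: f) = `|a| * opnorm f.
Proof.
apply/eqP; rewrite eq_le opnormZ_le /=.
have [->|a0] := eqVneq a 0; first by rewrite normr0 mul0r opnorm_ge0.
rewrite -ler_pdivlMl ?normr_gt0// -normfV.
by have := opnormZ_le a^-1 (a *: f); rewrite scalerA mulVf// scale1r.
Qed.

Fact opnorm0_eq0 (f : clin) : opnorm f = 0 -> f = 0.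
Proof.
move=> f0; apply/val_inj/funext => x /=.
have [->|x0] := eqVneq x 0; first by rewrite linear0.
have : `|f (`|x|^-1 *: x)| <= 0.
  by rewrite -f0 opnorm_ub// normrZ normfV normr_id mulVf ?normr_eq0.
rewrite linearZ/= normr_le0 scaler_eq0 invr_eq0 normr_eq0 (negPf x0)/=.
by move=> /eqP.
Qed.

HB.instance Definition _ :=
  Lmodule_isNormed.Build R clin opnormD opnormZ opnorm0_eq0.

End ContinuousLinearMaps.

Section BanachSpaces.
Context {R : realType}.

Definition dual (E : normedModType R) : normedModType R := clin E R^o.

Definition reflexive_space (E : normedModType R) : Prop :=
  forall Phi : dual (dual E), exists x : E, forall f : dual E, Phi f = f x.

Definition weak_cvg (E : normedModType R) (x : nat -> E) (l : E) : Prop :=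
  forall f : dual E, (fun n => f (x n)) @ \oo --> f l.

Definition hilbert_norm (V : normedModType R) : Prop :=
  exists ip : {dot V for (@idfun R)}, forall x : V, `|x| ^+ 2 = ip x x.

End BanachSpaces.

(** * Differentiability classes *)

Section SmoothMaps.
Context {R : realType}.

(* The differential ['d f x], repackaged as an element of [L(E, G)]. The
   default value 0 is only used when ['d f x] is not continuous, hence only at
   points where [f] is not differentiable. *)
Definition Diff (E G : normedModType R) (f : E -> G) (x : E) : clin E G :=
  insubd 0 ('d f x : E -> G).

Fact DiffE (E G : normedModType R) (f : E -> G) (x : E) :
  differentiable f x -> Diff f x = 'd f x :> (E -> G).
Proof.
move=> df; rewrite /Diff /insubd insubT//=; apply/asboolP.
by split; [exact: linearP|exact: diff_continuous].
Qed.

Definition C1_map (E G : normedModType R) (f : E -> G) : Prop :=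
  (forall x, differentiable f x) /\ continuous (Diff f).

Definition C2_map (E G : normedModType R) (f : E -> G) : Prop :=
  (forall x, differentiable f x) /\ C1_map (Diff f).

(* [D] need not be open: the first-order expansion and the continuity of the
   derivative are relative to [D], and the derivative need not be unique. *)
Definition C1_map_on (E G : normedModType R) (D : set E) (f : E -> G) : Prop :=
  exists df : E -> clin E G,
    (forall x, D x -> forall e : R, 0 < e -> \forall y \near x, D y ->
      `|f y - f x - df x (y - x)| <= e * `|y - x|) /\
    {within D, continuous df}.

Definition strongly_continuous_on (E G : normedModType R) (D : set E)
    (f : E -> G) : Prop :=
  forall (x : nat -> E) (l : E), (forall n, D (x n)) -> D l ->
    weak_cvg x l -> f (x n) @[n --> \oo] --> f l.

(* For [f : E -> R], [Diff f] has values in [dual E] and [Diff (Diff f) x] is in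
   [L(E, dual E)]: the pairing of [f''(x) h] with [h] is
   [Diff (Diff f) x h h]. *)
Definition convex_penalty (E : normedModType R) (f : E -> R^o) : Prop :=
  [/\ forall x, 0 <= f x, C2_map f, f 0 = 0, Diff f 0 = 0
    & exists2 C : R, 0 < C &
        forall x h : E, C * `|h| ^+ 2 <= Diff (Diff f) x h h].

End SmoothMaps.

(** * Constrained minimization *)

Definition global_minimizer {R : realType} {X : Type} (J : X -> R)
    (A : set X) (x : X) : Prop :=
  A x /\ forall y, A y -> J x <= J y.

Section Tikhonov.
Context {R : realType} {U W V : normedModType R}.
Variables (iota : U -> W) (F : W -> V) (RU : U -> R) (RW : W -> R).
Variables (alpha beta : R) (v : V).

Definition tikhonov (u : U) (w : W) (lambda : R) : R :=
  `|F (lambda *: iota u + (1 - lambda) *: w) - v| ^+ 2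
  + lambda * alpha * RU u + (1 - lambda) * beta * RW w.

(* At [lambda = 0] (resp. [lambda = 1]) the functional no longer depends on [u]
   (resp. [w]), so uniqueness only makes sense for the reduced functional of
   the remaining variable. *)
Definition tikhonov0 (w : W) : R := `|F w - v| ^+ 2 + beta * RW w.

Definition tikhonov1 (u : U) : R := `|F (iota u) - v| ^+ 2 + alpha * RU u.

End Tikhonov.

(* Main.v *)
From HB Require Import structures.
Require Import Defs.
From mathcomp Require Import all_boot all_order all_algebra.
From mathcomp Require Import all_classical all_reals all_analysis.
From mathcomp Require Import ring lra.

Set Implicit Arguments.
Unset Strict Implicit.
Unset Printing Implicit Defensive.

Import Order.TTheory GRing.Theory Num.Theory.
Import numFieldNormedType.Exports.
Local Open Scope classical_set_scope.
Local Open Scope ring_scope.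

(** The bound from below on the second derivative of [RW] makes its value at
    [0], once symmetrized, an inner product defining the topology of [W]. Hence
    from a filter converging weakly to [l] one extracts a sequence [x] with
    [x k - l] almost orthogonal: it converges weakly to [l] and its means
    converge in norm. So [D] is closed, and [F] continuous, along every
    bounded weakly convergent filter, and reflexivity gives weak limits along
    ultrafilters.

    Let [lambda] tend to [lambda0] along an ultrafilter. The minimal values are
    upper semicontinuous (recovery pairs keeping [lambda u + (1 - lambda) w]
    fixed), and strong convexity gives the lower bound
    [T(ub, wb, lambda0) + c lambda |u - ub|^2 + c (1 - lambda) |w - wb|^2 + o(1)]
    for them, [(ub, wb)] being the weak limit. Thus [(ub, wb)] is the minimizer
    at [lambda0] and the quadratic remainders tend to [0]. *)

(** * Bounded linear maps and the operator norm *)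

Section clin_theory.
Context {R : realType} (E G : normedModType R).

Lemma clin_norm_le (f : clin E G) (x : E) : `|f x| <= `|f| * `|x|.
Proof.
have [->|x0] := eqVneq x 0; first by rewrite linear0 !normr0 mulr0.
have x_gt0 : 0 < `|x| by rewrite normr_gt0.
have := @opnorm_ub _ _ _ f (`|x|^-1 *: x).
rewrite normrZ normfV normr_id mulVf ?normr_eq0// lexx => /(_ isT).
by rewrite linearZ/= normrZ normfV normr_id ler_pdivrMl// mulrC.
Qed.

Lemma clin_of_bounded (f : E -> G) (M : R) :
  linear f -> (forall x, `|f x| <= M * `|x|) ->
  exists g : clin E G, g = f :> (E -> G).
Proof.
move=> lf fM.
pose Lf := GRing.isLinear.Build R E G _ f lf.
pose F : {linear E -> G} := HB.pack f Lf.
have cf : continuous F.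
  apply/linear_bounded_continuous/bounded_funP => r; exists (`|M| * r) => x xr.
  apply: (le_trans (fM x)); apply: (le_trans (ler_wpM2r _ (ler_norm _))) => //.
  by rewrite ler_wpM2l.
have fE : f \in @clin_pred R E G by apply/asboolP; split => //; exact: cf.
by exists (CLin fE).
Qed.

End clin_theory.

(** * From a lower bound on the second derivative to strong convexity *)

Section second_order.
Context {R : realType} (E : normedModType R).

Lemma is_derive_line (G : normedModType R) (f : E -> G) (x h : E) (t : R) :
  differentiable f (x + t *: h) ->
  is_derive t 1 (fun s : R => f (x + s *: h)) ('d f (x + t *: h) h).
Proof.
move=> df.
have dl : is_diff t (cst x + ( *:%R ^~ h)) (0 + ( *:%R ^~ h)).
  exact: is_diffD.
have dfl : is_diff t (f \o (cst x + ( *:%R ^~ h)))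
    ('d f (x + t *: h) \o (0 + ( *:%R ^~ h))).
  by apply: is_diff_comp; apply: differentiableP.
apply: DeriveDef.
  by apply/diff_derivable; exact: (@ex_diff _ _ _ _ _ _ _ dfl).
rewrite deriveE; last exact: (@ex_diff _ _ _ _ _ _ _ dfl).
by rewrite diff_val /= fctE scale1r add0r.
Qed.

(** Evaluation at [h] is a bounded linear map on [clin E G], with constant [|h|], so it commutes
    with the limit of the difference quotients. *)
Lemma is_derive_clin_apply (G : normedModType R) (g : R -> clin E G) (h : E)
    (t : R) (dg : clin E G) :
  is_derive t 1 g dg -> is_derive t 1 (fun s => g s h) (dg h).
Proof.
case=> dgt dgE.
pose ev (k : clin E G) := k h.
have ev_lin : linear ev by move=> a k l; rewrite /ev clin_addE clin_scaleE.
have [evc evE] : exists e : clin (clin E G) G, e = ev :> (_ -> _).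
  apply: (@clin_of_bounded _ _ _ ev `|h|) => // k.
  by rewrite mulrC; exact: clin_norm_le.
have := cvg_comp _ _ dgt (@clin_continuous _ _ _ evc _).
rewrite evE -/('D_1 g t) dgE => H.
have H' : s^-1 *: (((fun s => g s h) \o shift t) (s *: (1:R)) - g t h) @[s --> 0^'] --> dg h.
  by apply: cvg_trans H; apply: near_eq_cvg; near=> s.
apply: DeriveDef; first by apply/cvg_ex; exists (dg h).
by apply/cvg_lim.
Unshelve. all: by end_near. Qed.

(** On the segment from [x] to [y] the slope of [f] grows at rate at least [C * |h|^2]. The mean
    value theorem is applied first to the slope, then to [f] minus its quadratic lower bound. *)
Lemma strong_convexity (f : E -> R^o) (C : R) : C2_map f ->
  (forall x h : E, C * `|h| ^+ 2 <= Diff (Diff f) x h h) ->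
  forall x y : E,
    f x + Diff f x (y - x) + C / 2 * `|y - x| ^+ 2 <= f y.
Proof.
move=> [df [ddf _]] hC x y; set h := y - x.
pose k (t : R) : R := Diff f (x + t *: h) h.
have dk (t : R) : is_derive t 1 k (Diff (Diff f) (x + t *: h) h h).
  by apply: is_derive_clin_apply; rewrite DiffE//; exact: is_derive_line.
have kt (t : R) : 0 <= t -> t * (C * `|h| ^+ 2) <= k t - k 0.
  move=> t0.
  have [|c _ ->] := @MVT_segment R k _ 0 t t0 (fun s _ => dk s).
    apply: continuous_subspaceT => s; apply/differentiable_continuous.
    by apply/derivable1_diffP; case: (dk s).
  by rewrite subr0 mulrC ler_wpM2r.
(* By [kt] the derivative of [phi] is nonnegative for [t >= 0], so [phi 0 <= phi 1], which is the
   claim. *)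
pose phi : R -> R := (fun t => f (x + t *: h)) - (k 0 \*: id)
   - ((C / 2 * `|h| ^+ 2) \*: (id ^+ 2)).
have dphi (t : R) : is_derive t 1 phi (k t - k 0 - t * (C * `|h| ^+ 2)).
  have d1 : is_derive t 1 (fun s : R => f (x + s *: h)) (k t).
    by rewrite /k DiffE//; exact: is_derive_line.
  have d2 := is_deriveZ (k 0) (is_derive_id t (1:R)).
  have d3 := is_deriveZ (C / 2 * `|h| ^+ 2) (is_deriveX 2 (is_derive_id t (1:R))).
  have := is_deriveB (is_deriveB d1 d2) d3.
  move=> /is_derive_eq; apply.
  rewrite /GRing.scale/=.
  move: (k t) (k 0) (`|h| ^+ 2) => a b c.
  by rewrite expr1; lra.
have [] := @MVT_segment R phi _ 0 1 ler01 (fun s _ => dphi s).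
  apply: continuous_subspaceT => s; apply/differentiable_continuous.
  by apply/derivable1_diffP; case: (dphi s).
move=> c; rewrite in_itv/= => /andP[c0 _].
have phiE s : phi s = f (x + s *: h) - k 0 * s - C / 2 * `|h| ^+ 2 * s ^+ 2 by [].
have -> : phi 1 = f y - k 0 - C / 2 * `|h| ^+ 2.
  by rewrite phiE scale1r (addrC x) subrK expr1n !mulr1.
have -> : phi 0 = f x by rewrite phiE scale0r addr0 expr0n !mulr0 !subr0.
have -> : Diff f x h = k 0 by rewrite /k scale0r addr0.
have := kt _ c0.
move: (k c) (k 0) (f x) (f y) (`|h| ^+ 2) (C / 2) => a b p q n C2 H1 H2.
lra.
Qed.

End second_order.

(** * Weak limits along ultrafilters *)

Section weak_limits.
Context {R : realType}.

(** Compactness of a segment gives a cluster point, and an ultrafilter converges to each of its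
    cluster points. *)
Lemma ultra_bounded_cvg (T : Type) (G : set_system T) (g : T -> R) (M : R) :
  UltraFilter G -> (\forall i \near G, `|g i| <= M) -> cvg (g i @[i --> G]).
Proof.
move=> GU gM; have GP : ProperFilter G := ultra_proper.
have [|p [_ clp]] := @segment_compact R (- M) M (g @ G) _.
  by apply: filterS gM => i; rewrite /= in_itv/= ler_norml.
apply/cvg_ex; exists p => A pA.
have [//|/= nA] := in_ultra_setVsetC (g @^-1` A) GU.
by have [y []] := clp (~` A) A nA pA.
Qed.

(** The limits of [f (x i)], taken for all [f] at once, form a bounded functional on the dual;
    reflexivity represents it by a point. *)
Lemma ultra_weak_cvg (E : normedModType R) (T : Type) (G : set_system T)
    (x : T -> E) (M : R) : reflexive_space E -> UltraFilter G ->
  (\forall i \near G, `|x i| <= M) ->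
  exists l : E, forall f : dual E, f (x i) @[i --> G] --> f l.
Proof.
move=> reflE GU xM; have GP : ProperFilter G := ultra_proper.
have fM (f : dual E) : \forall i \near G, `|f (x i)| <= M * `|f|.
  apply: filterS xM => i xiM; apply: (le_trans (clin_norm_le f _)).
  by rewrite mulrC ler_wpM2r.
have fc (f : dual E) : cvg (f (x i) @[i --> G]).
  exact: ultra_bounded_cvg (fM f).
pose Phi (f : dual E) : R^o := lim (f (x i) @[i --> G]).
have Phi_lin : linear Phi.
  move=> a f g.
  have H : (a * f (x i) + g (x i)) @[i --> G] --> a * Phi f + Phi g.
    by apply: cvgD; [apply: cvgMl_tmp; exact: fc|exact: fc].
  by rewrite /Phi -(cvg_lim _ H).
have Phi_bd (f : dual E) : `|Phi f| <= M * `|f|.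
  rewrite /Phi -(lim_norm (fc f)); apply: limr_le; last exact: fM.
  by apply: is_cvg_norm; exact: fc.
have [Psi PsiE] := clin_of_bounded Phi_lin Phi_bd.
have [l lE] := reflE Psi; exists l => f.
by rewrite -lE PsiE; exact: fc.
Qed.

End weak_limits.

(** * Almost orthogonal sequences *)

Section almost_orthogonal.
Context {R : realType} (E : normedModType R).
Variables (q : E -> dual E) (C K : R).
Hypotheses (q_sym : forall x y, q x y = q y x) (C_gt0 : 0 < C)
  (K_ge0 : 0 <= K)
  (q_lower : forall x, C * `|x| ^+ 2 <= q x x)
  (q_upper : forall x, q x x <= K * `|x| ^+ 2).

(** Greedy choice: given finitely many points [z], weak convergence to [0] makes all the [q z y]
    small for [G]-most [y]. *)
Lemma extract_almost_orthogonal (G : set_system E) (A : set E) :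
  ProperFilter G -> (forall f : dual E, f @ G --> (0 : R^o)) -> G A ->
  exists a : nat -> E, (forall k, A (a k)) /\
    forall j k, (j < k)%N -> k.+1%:R * `|q (a k) (a j)| <= 2^-1 ^+ k.
Proof.
move=> GP G0 GA.
have step (s : seq E) : exists y, A y /\ forall z, z \in s ->
    (size s).+1%:R * `|q y z| <= 2^-1 ^+ size s.
  have Gs e : 0 < e -> G (fun y => forall z, z \in s -> `|q y z| <= e).
    move=> e0; elim: s => [|z s IH]; first exact: filterE.
    have Gz : \forall y \near G, `|q z y| <= e.
      by have /cvgr0Pnorm_le/(_ _ e0) := G0 (q z).
    near=> y => z'; rewrite inE => /orP[/eqP ->|]; last first.
      by move: z'; near: y; exact: IH.
    by rewrite q_sym; near: y.
  have := Gs (2^-1 ^+ size s / (size s).+1%:R).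
  rewrite divr_gt0// ?exprn_gt0// => /(_ isT).
  move=> H; have [y [Ay yH]] := filter_ex (filterI GA H).
  exists y; split => // z zs; rewrite mulrC -ler_pdivlMr//; exact: yH.
have [pick pickP] := choice step.
(* [L n] lists the first [n] chosen points, so [pick (L k)] takes all earlier ones into account and
   [size (L k)] is [k]. *)
pose L := fix L n := if n is m.+1 then pick (L m) :: L m else [::].
exists (fun k => pick (L k)); split => [k|j k jk]; first exact: (pickP _).1.
have sL n : size (L n) = n by elim: n => //= n ->.
have := (pickP (L k)).2 (pick (L j)); rewrite sL; apply.
elim: k jk => // k IH; rewrite ltnS leq_eqVlt => /orP[/eqP ->|/IH] /=.
  by rewrite inE eqxx.
by rewrite inE orbC => ->.
Unshelve. all: by end_near. Qed.

Variables (a : nat -> E) (M : R).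
Hypotheses (aM : forall k, `|a k| <= M)
  (a_orth : forall j k, (j < k)%N -> k.+1%:R * `|q (a k) (a j)| <= 2^-1 ^+ k).

(** Expand the quadratic form: the diagonal contributes at most [K * M^2] times the sum of squares.
    The factor [k.+1] in [a_orth] pays for the number of cross terms, and the geometric factor makes
    their total finite. *)
Lemma almost_orthogonal_sum (t : nat -> R) (T : R) (n : nat) :
  (forall k, `|t k| <= T) ->
  C * `|\sum_(k < n) t k *: a k| ^+ 2
    <= K * M ^+ 2 * \sum_(k < n) t k ^+ 2 + 4 * T ^+ 2.
Proof.
move=> tT; have T0 : 0 <= T := le_trans (normr_ge0 _) (tT 0%N).
apply: (le_trans (q_lower _)).
(* Strengthened for the induction: from [n] to [n.+1] the last term grows by [2 * T^2 * 2^-n],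
   exactly the bound on the new cross term. *)
suff : q (\sum_(k < n) t k *: a k) (\sum_(k < n) t k *: a k) <=
    K * M ^+ 2 * \sum_(k < n) t k ^+ 2 + 4 * T ^+ 2 * (1 - 2^-1 ^+ n).
  move=> /le_trans; apply; rewrite lerD2l ler_piMr ?mulr_ge0 ?sqr_ge0//.
elim: n => [|n IH]; first by rewrite !big_ord0 linear0 mulr0 expr0 subrr mulr0 addr0.
rewrite !big_ord_recr /=; set S := \sum_(k < n) _ in IH *.
have -> : q (S + t n *: a n) (S + t n *: a n) =
    q S S + 2 * t n * q (a n) S + t n ^+ 2 * q (a n) (a n).
  rewrite linearD linearZ /= (q_sym _ S) (q_sym _ (a n)) !linearD !linearZ /=.
  by rewrite (q_sym S (a n)) /GRing.scale /=; move: (q _ _) (q _ _) (q _ _) => x y z; ring.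
have KM : q (a n) (a n) <= K * M ^+ 2.
  apply: (le_trans (q_upper _)); rewrite ler_wpM2l// lerXn2r ?nnegrE//.
  exact: le_trans (aM n).
have cross : `|q (a n) S| <= T * 2^-1 ^+ n.
  rewrite linear_sum (le_trans (ler_norm_sum _ _ _))//.
  have : \sum_(i < n) `|q (a n) (t i *: a i)| <= \sum_(i < n) T * (2^-1 ^+ n / n.+1%:R).
    apply: ler_sum => i _; rewrite linearZ normrM ler_pM//.
    by rewrite ler_pdivlMr// mulrC a_orth.
  move=> /le_trans; apply.
  rewrite sumr_const card_ord -[leLHS]mulr_natr -mulrA ler_wpM2l// -mulrA ler_piMr ?exprn_ge0//.
  by rewrite mulrC ler_pdivrMr// mul1r ler_nat.
have : t n * q (a n) S <= T ^+ 2 * 2^-1 ^+ n.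
  apply: (le_trans (ler_norm _)); rewrite normrM expr2 -mulrA.
  by apply: ler_pM.
have : t n ^+ 2 * q (a n) (a n) <= t n ^+ 2 * (K * M ^+ 2).
  by rewrite ler_wpM2l// sqr_ge0.
rewrite [2^-1 ^+ n.+1]exprSr.
move: IH; move: (q _ _) (q _ _) (q _ _) (\sum_(k < n) _) (2^-1 ^+ n) (t n) (K * M ^+ 2) (T ^+ 2).
move=> *; lra.
Qed.

(** A Bessel inequality. With coefficients [f (a k)], the value of [f] at the partial sum is the sum
    [Q n] of their squares, so [C * Q^2] is at most affine in [Q]. Hence [Q] is bounded, the series
    converges and its terms tend to [0]. *)
Lemma almost_orthogonal_weak (f : dual E) : f (a k) @[k --> \oo] --> (0 : R^o).
Proof.
pose t k : R := f (a k); pose T := `|f| * M.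
have tT k : `|t k| <= T.
  by apply: (le_trans (clin_norm_le f _)); rewrite ler_wpM2l.
pose Q := series (fun k => t k ^+ 2).
have fS n : f (\sum_(k < n) t k *: a k) = Q n.
  rewrite linear_sum /Q /series /= big_mkord; apply: eq_bigr => i _.
  by rewrite linearZ.
have Q0 n : 0 <= Q n by rewrite /Q /series /= sumr_ge0// => i _; exact: sqr_ge0.
pose c1 := `|f| ^+ 2 * (K * M ^+ 2); pose c2 := `|f| ^+ 2 * (4 * T ^+ 2).
have Qle n : C * Q n ^+ 2 <= c1 * Q n + c2.
  have := almost_orthogonal_sum n tT.
  have : Q n ^+ 2 <= (`|f| * `|\sum_(k < n) t k *: a k|) ^+ 2.
    rewrite lerXn2r ?nnegrE ?mulr_ge0// -fS.
    exact: le_trans (ler_norm _) (clin_norm_le f _).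
  rewrite exprMn /Q /series /= big_mkord -/(_ ^+ 2) => H1 H2.
  apply: (@le_trans _ _ (`|f| ^+ 2 * (C * `|\sum_(k < n) t k *: a k| ^+ 2))).
    by rewrite [leRHS]mulrCA ler_wpM2l// ltW.
  by rewrite /c1 /c2 -mulrA -mulrDr ler_wpM2l ?sqr_ge0.
have Qbd n : Q n <= 1 + (`|c1| + `|c2|) / C.
  have [Q1|/ltW Q1] := leP (Q n) 1.
    by rewrite (le_trans Q1)// lerDl divr_ge0 ?addr_ge0// ltW.
  rewrite -[leLHS]add0r lerD// ler_pdivlMr// mulrC.
  have Qn : 0 < Q n by rewrite (lt_le_trans _ Q1).
  rewrite -(ler_pM2r Qn) -mulrA -expr2 (le_trans (Qle n))// mulrDl lerD//.
    by rewrite ler_wpM2r// ler_norm.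
  by rewrite (le_trans (ler_norm _))// ler_peMr.
have Qc : cvgn Q.
  apply: nondecreasing_is_cvgn.
    by apply/nondecreasing_series => i _ _; exact: sqr_ge0.
  by exists (1 + (`|c1| + `|c2|) / C) => _ [n _ <-]; exact: Qbd.
have := cvg_series_cvg_0 Qc.
move=> t2; apply/cvgr0Pnorm_lt => e e0.
have /cvgr0Pnorm_lt/(_ (e ^+ 2)) := t2; rewrite exprn_gt0// => /(_ isT).
apply: filterS => k; rewrite normrX => tk.
by rewrite -(@ltr_pXn2r _ 2)// ?nnegrE// ltW.
Qed.

(** With unit coefficients the squared norm of the sum grows at most linearly, so that of the mean
    is of order [1/n]. *)
Lemma almost_orthogonal_mean :
  n.+1%:R^-1 *: \sum_(k < n.+1) a k @[n --> \oo] --> (0 : E).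
Proof.
apply/cvgr0Pnorm_lt => e e0.
have := @cvg_harmonic R => /cvgr0Pnorm_lt.
move=> /(_ (e ^+ 2 * C / (`|K * M ^+ 2| + 4))).
have D0 : 0 < `|K * M ^+ 2| + 4 by rewrite ltr_wpDl.
rewrite divr_gt0 ?mulr_gt0 ?exprn_gt0// => /(_ isT).
apply: filterS => n; rewrite ger0_norm ?harmonic_ge0// /harmonic/= => nlt.
have := @almost_orthogonal_sum (fun=> 1) 1 n.+1.
rewrite /=.
under eq_bigr do rewrite scale1r.
under [X in _ * X + _]eq_bigr do rewrite expr1n.
rewrite normr1 lexx => /(_ (fun=> isT)).
rewrite sumr_const card_ord expr1n mulr1.
set S := \sum_(i < n.+1) _ => H.
rewrite normrZ ger0_norm// -(@ltr_pXn2r _ 2)// ?nnegrE ?mulr_ge0 ?(ltW e0)//.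
rewrite exprMn -(ltr_pM2l C_gt0) mulrCA.
apply: (@le_lt_trans _ _ (n.+1%:R^-1 ^+ 2 * ((`|K * M ^+ 2| + 4) * n.+1%:R))).
  rewrite ler_wpM2l ?sqr_ge0// (le_trans H)// mulrDl lerD//.
    by rewrite ler_wpM2r// ler_norm.
  by rewrite ler_peMr// ler1n.
move: nlt; move: (`|K * M ^+ 2| + 4) D0 => D D0 nlt.
rewrite mulrCA expr2 -!mulrA mulVf// mulr1 mulrC -ltr_pdivlMr//.
by rewrite (mulrC C).
Qed.

End almost_orthogonal.

(** * Closedness and continuity along weakly convergent filters *)

Section weak_sequences.
Context {R : realType}.

(** An equivalent inner product, valued in the dual so that weak convergence applies to [q x]
    directly; linearity in [x] follows from symmetry. *)
Definition hilbertizable (E : normedModType R) : Prop :=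
  exists (q : E -> dual E) (C K : R),
    [/\ forall x y, q x y = q y x, 0 < C, 0 <= K,
        forall x, C * `|x| ^+ 2 <= q x x & forall x, q x x <= K * `|x| ^+ 2].

(* The inner product is the symmetrization of the second derivative at [0]. *)
Lemma convex_penalty_hilbertizable (E : normedModType R) (f : E -> R^o) :
  convex_penalty f -> hilbertizable E.
Proof.
case=> _ _ _ _ [C C0 hC]; pose B := Diff (Diff f) 0.
have Bbd x y : `|B x y| <= `|B| * `|x| * `|y|.
  apply: (le_trans (clin_norm_le (B x) y)).
  by rewrite ler_wpM2r//; exact: (clin_norm_le B x).
have qP x : exists g : dual E, forall y, g y = B x y + B y x.
  have [||g gE] := @clin_of_bounded _ E R^o (fun y => B x y + B y x : R^o)
      (2 * `|B| * `|x|).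
  - move=> a y z; rewrite !linearP clin_addE clin_scaleE /GRing.scale /=.
    move: (B x y) (B x z) (B y x) (B z x) => b1 b2 b3 b4. by rewrite -[a *: b1]/(a * b1); ring.
  - move=> y; apply: (le_trans (ler_normD _ _)).
    have := Bbd x y; have := Bbd y x.
    move: `|B| `|x| `|y| `|B x y| `|B y x| => b1 b2 b3 b4 b5; lra.
  by exists g => y; rewrite gE.
have [q qE] := choice qP.
exists q, (2 * C), (2 * `|B|); split=> //.
- by move=> x y; rewrite !qE addrC.
- by rewrite mulr_gt0.
- move=> x; rewrite qE; have := hC 0 x; rewrite -/B.
  by move: (B x x) (`|x| ^+ 2) => b n; lra.
- move=> x; rewrite qE; have := Bbd x x; have := ler_norm (B x x).
  rewrite -mulrA -expr2.
  by move: (B x x) `|B x x| `|B| (`|x| ^+ 2) => b b1 b2 n; lra.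
Qed.

Lemma convex_set_mean (E : normedModType R) (D : set E) (x : nat -> E) (n : nat) :
  convex_set D -> (forall k, D (x k)) ->
  D (n.+1%:R^-1 *: \sum_(k < n.+1) x k).
Proof.
move=> cD Dx; elim: n => [|n IH].
  by rewrite big_ord_recr big_ord0 /= add0r invr1 scale1r.
(* The weight of the old mean when one more point joins. *)
have p0 : 0 <= n.+1%:R / n.+2%:R :> R by rewrite divr_ge0.
have p1 : n.+1%:R / n.+2%:R <= 1 :> R by rewrite ler_pdivrMr// mul1r ler_nat.
have := cD _ _ (Itv01 p0 p1) (mem_set IH) (mem_set (Dx n.+1)).
rewrite inE /conv /= scalerA mulrAC divff// mul1r.
have -> : unstable.onem (n.+1%:R / n.+2%:R) = n.+2%:R^-1 :> R.
  rewrite /unstable.onem -[X in X - _](@divff _ n.+2%:R)// -mulrBl -natrB// subSnn.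
  by rewrite mul1r.
by rewrite -scalerDr [in X in _ -> X]big_ord_recr.
Qed.

(** Bridge from filters to sequences: translate [G] by [-l] and extract an almost orthogonal
    sequence within [A] and a ball. *)
Lemma weak_banach_saks (E : normedModType R) (G : set_system E) (l : E) (M : R)
    (A : set E) :
  hilbertizable E -> ProperFilter G -> (\forall x \near G, `|x| <= M) ->
  (forall f : dual E, f @ G --> f l) -> G A ->
  exists x : nat -> E, [/\ forall k, A (x k), weak_cvg x l
    & n.+1%:R^-1 *: (\sum_(k < n.+1) x k) @[n --> \oo] --> l].
Proof.
move=> [q [C [K [q_sym C0 K0 q_lo q_up]]]] GP GM Gl GA.
pose H : set_system E := (fun x => x - l) @ G.
have HP : ProperFilter H by exact: fmap_proper_filter.
have H0 (f : dual E) : f @ H --> (0 : R^o).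
  have fE : (fun x => f (x - l)) = (fun x => f x - f l).
    by apply/funext => x; rewrite linearB.
  change (f (x - l) @[x --> G] --> (0 : R^o)); rewrite fE -(subrr (f l)).
  by apply: cvgB; [exact: Gl|exact: cvg_cst].
have HA : H [set y | A (y + l) /\ `|y| <= M + `|l|].
  change (\forall x \near G, A (x - l + l) /\ `|x - l| <= M + `|l|).
  near=> x; rewrite subrK; split; first by near: x.
  by rewrite (le_trans (ler_normB _ _))// lerD2r; near: x.
have [a [Aa a_orth]] := extract_almost_orthogonal q_sym HP H0 HA.
have aM k : `|a k| <= M + `|l| := (Aa k).2.
exists (fun k => a k + l); split=> [k|f|]; first exact: (Aa k).1.
- have := almost_orthogonal_weak q_sym C0 K0 q_lo q_up aM a_orth f.
  move=> f0; rewrite -[f l]add0r.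
  have : f (a k) + f l @[k --> \oo] --> 0 + f l by apply: cvgD; [exact: f0|exact: cvg_cst].
  by under eq_cvg do rewrite -linearD.
- have := almost_orthogonal_mean q_sym C0 K0 q_lo q_up aM a_orth.
  move=> /(cvgD)/(_ (cvg_cst l)); rewrite add0r.
  apply: cvg_trans; apply: near_eq_cvg; near=> n.
  rewrite /= big_split/= sumr_const card_ord scalerDr -(scaler_nat _ l) scalerA.
  by rewrite mulVf// scale1r.
Unshelve. all: by end_near. Qed.

(** Plays the role of Mazur's lemma: by convexity the means of the extracted sequence stay in [D],
    and they converge in norm. *)
Lemma convex_closed_weak_cvg (E : normedModType R) (D : set E)
    (G : set_system E) (l : E) (M : R) :
  hilbertizable E -> closed D -> convex_set D ->
  ProperFilter G -> (\forall x \near G, `|x| <= M) ->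
  (forall f : dual E, f @ G --> f l) -> G D -> D l.
Proof.
move=> hE clD cD GP GM Gl GD.
have [x [Dx _ xl]] := weak_banach_saks hE GP GM Gl GD.
apply: (@closed_cvg _ _ _ _ _ D clD _ _ xl).
apply: nearW => n; exact: (convex_set_mean n cD Dx).
Qed.

(** Otherwise [F] stays at distance [e] from [F l] on a set [B] that [G] meets; a sequence extracted
    from the trace of [G] on [B] contradicts strong continuity. *)
Lemma strongly_continuous_weak_cvg (E V : normedModType R) (D : set E)
    (F : E -> V) (G : set_system E) (l : E) (M : R) :
  hilbertizable E -> strongly_continuous_on D F ->
  ProperFilter G -> (\forall x \near G, `|x| <= M) ->
  (forall f : dual E, f @ G --> f l) -> G D -> D l ->
  F @ G --> F l.
Proof.
move=> hE sF GP GM Gl GD Dl; apply: contrapT => /cvgrPdist_lt.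
move=> /existsNP[e /not_implyP[e0 nG]].
pose B := D `&` ~` [set x | `|F l - F x| < e].
pose H : set_system E := within B G.
have HP : ProperFilter H.
  apply: Build_ProperFilter_ex => // P HP'.
  apply: contrapT => nP; apply: nG.
  near=> x; apply: contrapT => Fx.
  apply: nP; exists x.
  have : B x by split => //; near: x.
  by near: x.
have HG : G `<=` H by move=> P GP'; apply: filterS GP'.
have Hl (f : dual E) : f @ H --> f l.
  by move=> P /Gl; exact: HG.
have HB : H B by exact: withinT.
have [x [Bx xl _]] := weak_banach_saks hE HP (HG _ GM) Hl HB.
have /cvgrPdist_lt/(_ e e0) := sF x l (fun n => (Bx n).1) Dl xl.
by move=> /filter_ex[n]; exact: (Bx n).2.
Unshelve. all: by end_near. Qed.

End weak_sequences.

(** * Penalties with varying weights *)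

Section penalties.
Context {R : realType} (E : normedModType R).

(** Avoids square roots: [|x|^2 <= a] yields [|x| <= 1 + a]. *)
Lemma le_sqr_add1 (a : R) : 0 <= a -> a <= (1 + a) ^+ 2.
Proof. by move=> a0; nra. Qed.

Lemma convex_penalty_lower (f : E -> R^o) : convex_penalty f ->
  exists2 C : R, 0 < C & forall x y : E,
    f x + Diff f x (y - x) + C * `|y - x| ^+ 2 <= f y.
Proof.
move=> [_ C2f _ _ [C C0 hC]]; exists (C / 2); first by rewrite divr_gt0.
exact: strong_convexity.
Qed.

Lemma convex_penalty_coercive (f : E -> R^o) : convex_penalty f ->
  exists2 C : R, 0 < C & forall x : E, C * `|x| ^+ 2 <= f x.
Proof.
move=> hf; have [C C0 hC] := convex_penalty_lower hf.
case: hf => _ _ f0 df0 _; exists C => // x.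
by have := hC 0 x; rewrite f0 df0 subr0 (_ : (0 : clin E R^o) x = 0)// !add0r.
Qed.

Lemma sqr_norm_cvg0 (T : Type) (G : set_system T) (FG : Filter G) (x : T -> E) :
  `|x i| ^+ 2 @[i --> G] --> (0 : R) -> x i @[i --> G] --> (0 : E).
Proof.
move=> x2; apply/cvgr0Pnorm_lt => e e0.
have /cvgr0Pnorm_lt/(_ (e ^+ 2)) := x2; rewrite exprn_gt0// => /(_ isT).
apply: filterS => i; rewrite ger0_norm ?sqr_ge0// => xi.
by rewrite -(@ltr_pXn2r _ 2)// ?nnegrE// ltW.
Qed.

Lemma weighted_sqr_norm_cvg (T : Type) (G : set_system T) (FG : Filter G)
    (c : T -> R) (c0 : R) (x : T -> E) (l : E) : 0 < c0 ->
  c i @[i --> G] --> c0 ->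
  c i * `|x i - l| ^+ 2 @[i --> G] --> (0 : R) -> x i @[i --> G] --> l.
Proof.
move=> c0_gt0 cc0 cx.
have : x i - l @[i --> G] --> 0.
  apply: sqr_norm_cvg0.
  have : (c i)^-1 * (c i * `|x i - l| ^+ 2) @[i --> G] --> c0^-1 * 0.
    apply: cvgM => //. apply: cvgV => //. exact: lt0r_neq0.
  rewrite mulr0; apply: cvg_trans; apply: near_eq_cvg.
  near=> i; rewrite /= mulKf// gt_eqF//.
  by near: i; exact: (cvgr_gt c0 cc0).
by move/subr_cvg0.
Unshelve. all: by end_near. Qed.

(* For [c0 = 0] the points [x i] may be unbounded and [l] is [0]. *)
Lemma weighted_penalty_weak_limit (f : E -> R^o) (T : Type) (G : set_system T)
    (c : T -> R) (c0 N : R) (x : T -> E) :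
  reflexive_space E -> convex_penalty f -> UltraFilter G ->
  (\forall i \near G, 0 <= c i <= 1) -> 0 <= c0 -> c i @[i --> G] --> c0 ->
  (\forall i \near G, c i * f (x i) <= N) ->
  exists (l : E) (C M : R) (r : T -> R),
    [/\ 0 < C, \forall i \near G, `|c i *: x i| <= M,
        forall g : dual E, g (c i *: x i) @[i --> G] --> c0 * g l,
        r i @[i --> G] --> (0 : R)
      & \forall i \near G,
          c0 * f l + C * (c i * `|x i - l| ^+ 2) + r i <= c i * f (x i)].
Proof.
move=> rE hf GU c01 c0_ge0 cc0 cfN; have GP : ProperFilter G := ultra_proper.
have [D D0 fD] := convex_penalty_coercive hf.
have [C C0 fC] := convex_penalty_lower hf.
pose N' := `|N| / D.
have cxN : \forall i \near G, c i * `|x i| ^+ 2 <= N'.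
  near=> i.
  have /andP[ci0 _] : 0 <= c i <= 1 by near: i.
  rewrite /N' ler_pdivlMr// mulrC mulrCA (le_trans _ (ler_norm N))//.
  have : c i * f (x i) <= N by near: i.
  by apply: le_trans; rewrite ler_wpM2l.
have N'0 : 0 <= N' by rewrite divr_ge0// ltW.
(* One factor [c i] is kept: this bounds [c i *: x i], and also sends it to [0] in norm when
   [c0 = 0]. *)
have cxM : \forall i \near G, `|c i *: x i| ^+ 2 <= c i * N'.
  near=> i.
  have /andP[ci0 _] : 0 <= c i <= 1 by near: i.
  rewrite normrZ ger0_norm// exprMn expr2 -mulrA ler_wpM2l//.
  by near: i.
have cxB : \forall i \near G, `|c i *: x i| <= 1 + N'.
  near=> i.
  have /andP[ci0 ci1] : 0 <= c i <= 1 by near: i.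
  rewrite -(@ler_pXn2r _ 2)// ?nnegrE ?addr_ge0//.
  apply: (@le_trans _ _ (c i * N')); first by near: i.
  apply: (@le_trans _ _ N'); first by rewrite ler_piMl.
  exact: le_sqr_add1.
move: c0_ge0; rewrite le_eqVlt => /orP[/eqP c0E|c0_gt0].
  exists 0, D, (1 + N'), (fun=> 0); split=> //.
  - move=> g; rewrite -c0E mul0r.
    have cx0 : c i *: x i @[i --> G] --> (0 : E).
      apply: sqr_norm_cvg0; apply: (@squeeze_cvgr _ _ _ _ (fun=> 0) (fun i => c i * N')).
      + by apply: filterS cxM => i ->; rewrite sqr_ge0.
      + exact: cvg_cst.
      + have : c i * N' @[i --> G] --> c0 * N' by apply: cvgM => //; exact: cvg_cst.
        by rewrite -c0E mul0r.
    have := cvg_comp _ _ cx0 (@clin_continuous _ _ _ g 0).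
    by rewrite linear0.
  - exact: cvg_cst.
  - near=> i; have /andP[ci0 _] : 0 <= c i <= 1 by near: i.
    by rewrite -c0E mul0r add0r addr0 subr0 mulrCA ler_wpM2l.
(* For [c0 > 0], eventually [c i > c0 / 2], so the points themselves are bounded and have a weak
   limit. *)
have xB : \forall i \near G, `|x i| <= 1 + 2 * N' / c0.
  have B0 : 0 <= 2 * N' / c0 by apply: divr_ge0; [exact: mulr_ge0|exact: ltW].
  near=> i.
  have ci : c0 / 2 < c i.
    near: i; apply: (cvgr_gt c0 cc0).
    by rewrite ltr_pdivrMr// ltr_pMr// ltr1n.
  rewrite -(@ler_pXn2r _ 2)// ?nnegrE ?addr_ge0//.
  apply: (@le_trans _ _ (2 * N' / c0)).
    rewrite ler_pdivlMr// mulrC -ler_pdivrMl// mulrA (mulrC _ c0).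
    apply: (@le_trans _ _ (c i * `|x i| ^+ 2)); last by near: i.
    by rewrite ler_wpM2r ?sqr_ge0// ltW.
  exact: le_sqr_add1.
have [l xl] := ultra_weak_cvg rE GU xB.
(* The remainder collects the change of weight at [f l] and the linear term of the convexity
   inequality at [l]; the latter vanishes by weak convergence. *)
exists l, C, (1 + N'), (fun i => (c i - c0) * f l + c i * Diff f l (x i - l)).
split=> //.
- move=> g; have : c i * g (x i) @[i --> G] --> c0 * g l.
    by apply: cvgM => //; exact: xl.
  by under eq_cvg do rewrite -[_ * _]linearZ.
- rewrite -[X in _ --> X](addr0 0) -[X in _ --> X + _](mul0r (f l)) -[X in _ --> _ + X](mulr0 c0).
  apply: cvgD; apply: cvgM => //.
  + by rewrite -(subrr c0); apply: cvgB => //; exact: cvg_cst.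
  + exact: cvg_cst.
  + have dE : (fun i => Diff f l (x i - l)) = (fun i => Diff f l (x i) - Diff f l l).
      by apply/funext => i; rewrite linearB.
    rewrite dE -(subrr (Diff f l l)); apply: cvgB; [exact: xl|exact: cvg_cst].
- near=> i; have /andP[ci0 _] : 0 <= c i <= 1 by near: i.
  apply: le_trans (ler_wpM2l ci0 (fC l (x i))).
  move: (Diff f l (x i - l)) (f l) (c i) (`|x i - l| ^+ 2) => d fl ci n.
  by rewrite le_eqVlt; apply/orP; left; apply/eqP; ring.
Unshelve. all: by end_near. Qed.

End penalties.

(** * Stability of the minimizers *)

Section stability.
Context {R : realType} (U W V : normedModType R).

(** [C * |iota x|^2 <= RW (iota x) <= RU x], and [RU] is continuous at [0] with value [0] there. *)
Lemma penalty_embedding_continuous (iota : {linear U -> W})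
    (RU : U -> R^o) (RW : W -> R^o) :
  convex_penalty RU -> convex_penalty RW ->
  (forall x : U, RW (iota x) <= RU x) -> continuous iota.
Proof.
move=> hRU hRW RWU; have [C C0 hC] := convex_penalty_coercive hRW.
apply: bounded_linear_continuous; apply: continuous_linear_bounded.
suff : iota x @[x --> (0 : U)] --> (0 : W) by rewrite -[X in _ --> X -> _](linear0 iota).
apply/cvgr0Pnorm_lt => e e0.
have [_ [dRU _] RU0 _ _] := hRU.
have cRU : RU x @[x --> (0 : U)] --> (0 : R^o).
  by rewrite -RU0; exact: (differentiable_continuous (dRU 0)).
have /cvgr0Pnorm_lt/(_ (C * e ^+ 2)) := cRU.
rewrite mulr_gt0 ?exprn_gt0// => /(_ isT).
apply: filterS => x xe; rewrite -(@ltr_pXn2r _ 2)// ?nnegrE ?(ltW e0)//.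
rewrite -(ltr_pM2l C0) (le_lt_trans (hC _))// (le_lt_trans (RWU _))//.
exact: le_lt_trans (ler_norm _) xe.
Qed.

Variables (iota : {linear U -> W}) (D : set W) (F : W -> V)
  (RU : U -> R^o) (RW : W -> R^o) (alpha beta : R) (v : V)
  (u : R -> U) (w : R -> W).
Hypotheses (hW : reflexive_space W) (hU : reflexive_space U)
  (D_closed : closed D) (D_convex : convex_set D)
  (F_strong : strongly_continuous_on D F)
  (hRW : convex_penalty RW) (hRU : convex_penalty RU)
  (iota_cont : continuous iota)
  (alpha_gt0 : 0 < alpha) (beta_gt0 : 0 < beta).

Local Notation T := (tikhonov iota F RU RW alpha beta v).
Local Notation feasible x y lambda :=
  (D (lambda *: iota x + (1 - lambda) *: y)).

Hypothesis min_feasible : forall lambda, 0 <= lambda <= 1 ->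
  feasible (u lambda) (w lambda) lambda.
Hypothesis min_le : forall lambda x y, 0 <= lambda <= 1 ->
  feasible x y lambda -> T (u lambda) (w lambda) lambda <= T x y lambda.

(* Recovery sequence: near [lambda0 < 1] keep [u lambda0] and the point
   [z0 = lambda0 u + (1 - lambda0) w] of [D], and solve for [w]. At
   [lambda0 = 1], where [z0 = u 1], use the constant pair [(u 1, u 1)]. *)
Lemma value_usc (lambda0 : R) : 0 <= lambda0 <= 1 ->
  exists g : R -> R,
    [/\ g lambda @[lambda --> lambda0] --> T (u lambda0) (w lambda0) lambda0
      & \forall lambda \near lambda0, 0 <= lambda <= 1 ->
          T (u lambda) (w lambda) lambda <= g lambda].
Proof.
move=> l01; set u0 := u lambda0; set w0 := w lambda0.
have cC (c : R) : cst c @ lambda0 --> c by exact: cvg_cst.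
have cI : id @ lambda0 --> lambda0 by exact: cvg_id.
have c1 : (1 - lambda : R) @[lambda --> lambda0] --> (1 - lambda0 : R).
  by apply: cvgB; [exact: cC|exact: cI].
have [l1|l1] := ltP lambda0 1; last first.
  have lE : lambda0 = 1 by apply/eqP; rewrite eq_le l1 andbT; case/andP: l01.
  exists (fun lambda => T u0 (iota u0) lambda); split; last first.
    near=> lambda => ll; apply: min_le => //.
    rewrite -scalerDl addrC subrK scale1r.
    have := min_feasible l01.
    by rewrite -/u0 lE subrr scale0r addr0 scale1r.
  have -> : T u0 w0 lambda0 = `|F (iota u0) - v| ^+ 2
      + lambda0 * alpha * RU u0 + (1 - lambda0) * beta * RW (iota u0).
    by rewrite /tikhonov lE subrr !scale0r !mul0r !addr0 scale1r.
  have TE : (fun lambda => T u0 (iota u0) lambda) = (fun lambda =>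
      `|F (iota u0) - v| ^+ 2 + lambda * alpha * RU u0
      + (1 - lambda) * beta * RW (iota u0)).
    apply/funext => lambda.
    by rewrite /tikhonov -scalerDl [lambda + _]addrC subrK scale1r.
  rewrite TE; apply: cvgD; [apply: cvgD; [exact: cC|]|];
    do 2?(apply: cvgM; last exact: cC) => //.
pose z0 := lambda0 *: iota u0 + (1 - lambda0) *: w0.
pose w' (lambda : R) := (1 - lambda)^-1 *: (z0 - lambda *: iota u0).
have zE lambda : 1 - lambda != 0 ->
    lambda *: iota u0 + (1 - lambda) *: w' lambda = z0.
  by move=> l0; rewrite /w' scalerA mulfV// scale1r addrC subrK.
have cw' : w' lambda @[lambda --> lambda0] --> w0.
  have -> : w0 = (1 - lambda0)^-1 *: (z0 - lambda0 *: iota u0).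
    rewrite /z0 addrAC subrr add0r scalerA mulVf ?scale1r//.
    by rewrite subr_eq0 gt_eqF.
  apply: cvgZ; first by apply: cvgV => //; rewrite subr_eq0 gt_eqF.
  apply: cvgB; first exact: cvg_cst.
  by apply: cvgZr_tmp.
exists (fun lambda => `|F z0 - v| ^+ 2 + lambda * alpha * RU u0
    + (1 - lambda) * beta * RW (w' lambda)); split; last first.
  near=> lambda => ll.
  have lt1 : lambda < 1 by near: lambda; exact: (cvgr_lt lambda0 cI).
  have l0 : 1 - lambda != 0 by rewrite subr_eq0 gt_eqF.
  apply: (le_trans (min_le (x := u0) (y := w' lambda) ll _)).
    by rewrite zE//; exact: min_feasible.
  by rewrite /tikhonov zE.
have [_ [dRW _] _ _ _] := hRW.
apply: cvgD; [apply: cvgD; [exact: cC|]|].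
  by do 2?(apply: cvgM; last exact: cC).
apply: cvgM; first by apply: cvgM; last exact: cC.
exact: (cvg_comp _ _ cw' (differentiable_continuous (dRW w0))).
Unshelve. all: by end_near. Qed.

Hypothesis min_unique : forall lambda x y, 0 <= lambda <= 1 ->
  feasible x y lambda -> T x y lambda <= T (u lambda) (w lambda) lambda ->
  (0 < lambda -> x = u lambda) /\ (lambda < 1 -> y = w lambda).
Hypothesis D_meets_U : D `&` range iota !=set0.

Lemma minimizers_ultra_cvg (G : set_system R) (lambda0 : R) :
  0 <= lambda0 <= 1 -> UltraFilter G -> G [set` `[0, 1]] -> G --> lambda0 ->
  (0 < lambda0 -> u @ G --> u lambda0) /\ (lambda0 < 1 -> w @ G --> w lambda0).
Proof.
move=> l01 GU G01 Gl; have GP : ProperFilter G by exact: ultra_proper.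
have [_ [/[swap] [[a _ <-]] Da]] := D_meets_U.
have RU0 x : 0 <= RU x by case: hRU.
have RW0 x : 0 <= RW x by case: hRW.
(* The pair [(a, iota a)] is feasible for every weight, so [N] bounds all minimal values on
   [[0, 1]]. *)
pose N := `|F (iota a) - v| ^+ 2 + alpha * RU a + beta * RW (iota a).
have TN l : 0 <= l <= 1 -> T (u l) (w l) l <= N.
  move=> ll; apply: (le_trans (min_le (x := a) (y := iota a) ll _)).
    by rewrite -scalerDl addrC subrK scale1r.
  rewrite /tikhonov -scalerDl [l + _]addrC subrK scale1r.
  have /andP[? ?] := ll.
  rewrite !lerD// -mulrA ler_piMl// ?mulr_ge0 ?gerBl ?(ltW alpha_gt0) ?(ltW beta_gt0)//.
have near01 : \forall l \near G, 0 <= l <= 1.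
  by apply: filterS G01 => l; rewrite /= in_itv.
have near10 : \forall l \near G, 0 <= 1 - l <= 1.
  by apply: filterS near01 => l /andP[? ?]; rewrite subr_ge0 gerBl; apply/andP.
have l10 : 0 <= 1 - lambda0 by rewrite subr_ge0; case/andP: l01.
have c1 : (1 - l : R) @[l --> G] --> (1 - lambda0 : R).
  by apply: cvgB => //; exact: cvg_cst.
have bU : \forall l \near G, l * RU (u l) <= N / alpha.
  apply: filterS near01 => l ll; have /andP[? ?] := ll.
  rewrite ler_pdivlMr// mulrAC (le_trans _ (TN _ ll))// /tikhonov.
  by rewrite -addrA addrCA lerDl addr_ge0 ?sqr_ge0// !mulr_ge0 ?subr_ge0// ltW.
have bW : \forall l \near G, (1 - l) * RW (w l) <= N / beta.
  apply: filterS near01 => l ll; have /andP[? ?] := ll.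
  rewrite ler_pdivlMr// mulrAC (le_trans _ (TN _ ll))// /tikhonov.
  by rewrite lerDr addr_ge0 ?sqr_ge0// !mulr_ge0 ?subr_ge0// ltW.
have [ub [C1 [M1 [r1 [C1_gt0 uM u_weak r1_0 u_lsc]]]]] :=
  weighted_penalty_weak_limit hU hRU GU near01 (andP l01).1 Gl bU.
have [wb [C2 [M2 [r2 [C2_gt0 wM w_weak r2_0 w_lsc]]]]] :=
  weighted_penalty_weak_limit hW hRW GU near10 l10 c1 bW.
pose z l := l *: iota (u l) + (1 - l) *: w l.
pose zb := lambda0 *: iota ub + (1 - lambda0) *: wb.
have iotaE : (iota : U -> W) \in @clin_pred R U W.
  by apply/asboolP; split => //; exact: linearP.
pose A : clin U W := CLin iotaE.
(* Only the weighted points are known to be bounded: [u l] or [w l] may blow up where its weight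
   tends to [0]. *)
have zM : \forall y \near z @ G, `|y| <= `|A| * M1 + M2.
  change (\forall l \near G, `|z l| <= `|A| * M1 + M2).
  near=> l; rewrite /z -linearZ (le_trans (ler_normD _ _))// lerD//; last first.
    by near: l.
  apply: (le_trans (clin_norm_le A _)); rewrite ler_wpM2l//.
  by near: l.
have z_weak (f : dual W) : f @ (z @ G) --> f zb.
  have [||fA fAE] := @clin_of_bounded _ U R^o (fun x => f (iota x)) (`|f| * `|A|).
  - by move=> c x y; rewrite !linearP.
  - move=> x; apply: (le_trans (clin_norm_le f _)).
    by rewrite -mulrA ler_wpM2l//; exact: (clin_norm_le A).
  have -> : f zb = lambda0 * fA ub + (1 - lambda0) * f wb.
    by rewrite /zb linearD !linearZ fAE.
  have : fA (l *: u l) + f ((1 - l) *: w l) @[l --> G] -->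
    lambda0 * fA ub + (1 - lambda0) * f wb.
    by apply: cvgD; [exact: u_weak|exact: w_weak].
  have -> : (fun l => fA (l *: u l) + f ((1 - l) *: w l)) = f \o z.
    by apply/funext => l; rewrite /= /z linearD -linearZ fAE.
  by [].
have zD : (z @ G) D.
  by apply: filterS near01 => l; exact: min_feasible.
have hilbW := convex_penalty_hilbertizable hRW.
have Dzb : D zb.
  exact: (convex_closed_weak_cvg hilbW D_closed D_convex _ zM z_weak zD).
have Fz : F (z l) @[l --> G] --> F zb.
  exact: (strongly_continuous_weak_cvg hilbW F_strong _ zM z_weak zD Dzb).
have [g [gl g_ge]] := value_usc l01.
(* The gap between the upper bound [g] and the lower bound stripped of its quadratic remainders; it
   dominates them by [s_le]. *)
pose h l := g l - (`|F (z l) - v| ^+ 2 + alpha * (lambda0 * RU ub + r1 l)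
  + beta * ((1 - lambda0) * RW wb + r2 l)).
pose s1 l := l * `|u l - ub| ^+ 2; pose s2 l := (1 - l) * `|w l - wb| ^+ 2.
have h_lim : h l @[l --> G] -->
    T (u lambda0) (w lambda0) lambda0 - T ub wb lambda0.
  have -> : T ub wb lambda0 = `|F zb - v| ^+ 2
      + alpha * (lambda0 * RU ub + 0) + beta * ((1 - lambda0) * RW wb + 0).
    by rewrite /tikhonov -/zb !addr0 !mulrA (mulrC alpha) (mulrC beta).
  have cC (c : R) : cst c @ G --> c by exact: cvg_cst.
  apply: cvgB; first exact: (cvg_trans (cvg_app g Gl) gl).
  apply: cvgD; [apply: cvgD|].
  - rewrite expr2; have nF : `|F (z l) - v| @[l --> G] --> `|F zb - v|.
      by apply: cvg_norm; apply: cvgB => //; exact: cvg_cst.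
    by under eq_cvg do rewrite expr2; exact: cvgM.
  - by apply: cvgM; [exact: cC|apply: cvgD => //; exact: cC].
  - by apply: cvgM; [exact: cC|apply: cvgD => //; exact: cC].
have s_le : \forall l \near G, alpha * C1 * s1 l + beta * C2 * s2 l <= h l.
  near=> l; rewrite /h lerBrDr.
  have ll : 0 <= l <= 1 by near: l.
  have H : T (u l) (w l) l <= g l.
    suff : 0 <= l <= 1 -> T (u l) (w l) l <= g l by apply.
    by near: l; exact: (Gl _ g_ge).
  apply: le_trans H; rewrite /tikhonov -/(z l).
  have H1 : alpha * (lambda0 * RU ub + C1 * s1 l + r1 l) <= alpha * (l * RU (u l)).
    by rewrite ler_pM2l//; near: l.
  have H2 : beta * ((1 - lambda0) * RW wb + C2 * s2 l + r2 l)
      <= beta * ((1 - l) * RW (w l)).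
    by rewrite ler_pM2l//; near: l.
  move: H1 H2.
  move: (RU _) (RW _) (RU _) (RW _) (s1 l) (s2 l) (r1 l) (r2 l) (_ ^+ 2).
  move=> x1 x2 x3 x4 x5 x6 x7 x8 x9; lra.
have s1_0 : \forall l \near G, 0 <= s1 l.
  by apply: filterS near01 => l /andP[? _]; rewrite mulr_ge0 ?sqr_ge0.
have s2_0 : \forall l \near G, 0 <= s2 l.
  by apply: filterS near10 => l /andP[? _]; rewrite mulr_ge0 ?sqr_ge0.
(* One inequality is minimality at [lambda0]; the other holds because [h] is eventually nonnegative.
   So [h] tends to [0]. *)
have Tb : T (u lambda0) (w lambda0) lambda0 = T ub wb lambda0.
  apply/eqP; rewrite eq_le min_le//= -subr_ge0.
  apply: (cvgr_to_ge h_lim).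
  near=> l; apply: (@le_trans _ _ (alpha * C1 * s1 l + beta * C2 * s2 l)).
    apply: addr_ge0; apply: mulr_ge0.
    - exact: ltW (mulr_gt0 _ _).
    - by near: l.
    - exact: ltW (mulr_gt0 _ _).
    - by near: l.
  by near: l.
have [ubE wbE] : (0 < lambda0 -> ub = u lambda0) /\ (lambda0 < 1 -> wb = w lambda0).
  by apply: min_unique => //; rewrite Tb.
have s_cvg (k : R) (s s' : R -> R) : 0 < k -> (\forall l \near G, 0 <= s l) ->
    (\forall l \near G, 0 <= s' l) ->
    (\forall l \near G, k * s l + s' l <= h l) -> s @ G --> (0 : R).
  move=> k0 s0 s'0 sh.
  apply: (@squeeze_cvgr _ _ _ _ (fun=> 0) (fun l => k^-1 * h l)).
  - near=> l; apply/andP; split; first by near: l.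
    rewrite ler_pdivlMl// (@le_trans _ _ (k * s l + s' l))//; last by near: l.
    by rewrite lerDl; near: l.
  - exact: cvg_cst.
  - have : k^-1 * h l @[l --> G] --> k^-1 * 0.
      by apply: cvgM; [exact: cvg_cst|rewrite Tb subrr in h_lim].
    by rewrite mulr0.
split=> l0.
- rewrite -(ubE l0); apply: (weighted_sqr_norm_cvg _ l0 Gl).
  apply: (s_cvg (alpha * C1) _ (fun l => beta * C2 * s2 l)) => //.
    by rewrite mulr_gt0.
  by apply: filterS s2_0 => l ?; apply: mulr_ge0 => //; exact: ltW (mulr_gt0 _ _).
- rewrite -(wbE l0); apply: (weighted_sqr_norm_cvg _ _ c1); first by rewrite subr_gt0.
  apply: (s_cvg (beta * C2) _ (fun l => alpha * C1 * s1 l)) => //.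
  + by rewrite mulr_gt0.
  + by apply: filterS s1_0 => l ?; apply: mulr_ge0 => //; exact: ltW (mulr_gt0 _ _).
  + by apply: filterS s_le => l; rewrite addrC.
Unshelve. all: by end_near. Qed.

End stability.

(** * From ultrafilters to continuity *)

Lemma ultra_cvg (T : Type) (Y : topologicalType) (G : set_system T)
    (f : T -> Y) (y : Y) : Filter G ->
  (forall H, UltraFilter H -> G `<=` H -> f @ H --> y) -> f @ G --> y.
Proof.
move=> FG GH P yP; apply: contrapT => nP.
(* If [G] missed this preimage, its trace on the complement [B] would be proper, and an ultrafilter
   refining that trace would contain both [B] and the preimage. *)
pose B := ~` (f @^-1` P).
have BP : ProperFilter (within B G).
  apply: Build_ProperFilter_ex => Q GQ; apply: contrapT => nQ; apply: nP.
  change (G (f @^-1` P)); have GBQ : G [set x | B x -> Q x] by [].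
  apply: filterS GBQ => x BQ; apply: contrapT => Px.
  by apply: nQ; exists x; exact: BQ.
have [H [HU GH']] := ultraFilterLemma BP.
have HP : ProperFilter H by exact: ultra_proper.
have HfP : H (f @^-1` P).
  by apply: (GH H HU) yP => Q GQ; apply: GH'; apply: filterS GQ.
have HB : H B by apply: GH'; exact: withinT.
by have [x []] := filter_ex (filterI HfP HB).
Qed.

Theorem theorem2p1 (R : realType)
    (U W V : completeNormedModType R) (iota : {linear U -> W})
    (D : set W) (F : W -> V) (RU : U -> R^o) (RW : W -> R^o)
    (alpha beta : R) (v : V) (u : R -> U) (w : R -> W)
    (hV : hilbert_norm V) (hW : reflexive_space W) (hU : reflexive_space U)
    (iota_inj : injective iota) (iota_closed : closed (range iota))
    (iota_proper : range iota `<` setT)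
    (D_closed : closed D) (D_convex : convex_set D)
    (D_meets_U : D `&` range iota !=set0)
    (F_strong : strongly_continuous_on D F) (F_C1 : C1_map_on D F)
    (hRW : convex_penalty RW)
    (hRU : convex_penalty RU) (RW_le_RU : forall x : U, RW (iota x) <= RU x)
    (beta_gt0 : 0 < beta) (beta_le_alpha : beta <= alpha)
    (min_interior : forall lambda : R, 0 < lambda < 1 ->
      unique (global_minimizer
          (fun p : U * W => tikhonov iota F RU RW alpha beta v p.1 p.2 lambda)
          [set p : U * W | D (lambda *: iota p.1 + (1 - lambda) *: p.2)])
        (u lambda, w lambda))
    (min0 : unique (global_minimizer (tikhonov0 F RW beta v) D) (w 0))
    (min1 : unique (global_minimizer (tikhonov1 iota F RU alpha v)
                      [set x : U | D (iota x)]) (u 1)) :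
  {within `[0, 1[, continuous w} /\ {within `]0, 1], continuous u}.
Proof.
have alpha_gt0 : 0 < alpha := lt_le_trans beta_gt0 beta_le_alpha.
have iota_cont := penalty_embedding_continuous hRU hRW RW_le_RU.
have T0 x y : tikhonov iota F RU RW alpha beta v x y 0 = tikhonov0 F RW beta v y.
  by rewrite /tikhonov scale0r add0r subr0 scale1r !mul0r addr0 mul1r.
have T1 x y : tikhonov iota F RU RW alpha beta v x y 1 =
    tikhonov1 iota F RU alpha v x.
  by rewrite /tikhonov subrr scale0r addr0 scale1r !mul0r addr0 mul1r.
have split01 (lambda : R) : 0 <= lambda <= 1 ->
    [\/ lambda = 0, lambda = 1 | 0 < lambda < 1].
  move=> /andP[]; rewrite le_eqVlt => /orP[/eqP <-|l0]; first by constructor 1.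
  rewrite le_eqVlt => /orP[/eqP ->|l1]; first by constructor 2.
  by constructor 3; rewrite l0.
(* The hypotheses at [0], at [1] and in between are merged into statements on all of [[0, 1]], with
   uniqueness claimed only for a component of positive weight. *)
have feasible lambda : 0 <= lambda <= 1 ->
    D (lambda *: iota (u lambda) + (1 - lambda) *: w lambda).
  move=> /split01[->|->|/min_interior[[]//]].
  - by rewrite scale0r add0r subr0 scale1r; case: min0 => [[]].
  - by rewrite subrr scale0r addr0 scale1r; case: min1 => [[]].
have minimal lambda x y : 0 <= lambda <= 1 ->
    D (lambda *: iota x + (1 - lambda) *: y) ->
    tikhonov iota F RU RW alpha beta v (u lambda) (w lambda) lambda
      <= tikhonov iota F RU RW alpha beta v x y lambda.
  move=> /split01[->|->|/min_interior[[_ minl] _]] Dxy.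
  - rewrite !T0; case: min0 => [[_ minl] _]; apply: minl.
    by move: Dxy; rewrite scale0r add0r subr0 scale1r.
  - rewrite !T1; case: min1 => [[_ minl] _]; apply: minl.
    by move: Dxy; rewrite subrr scale0r addr0 scale1r.
  - exact: (minl (x, y)).
have uniq lambda x y : 0 <= lambda <= 1 ->
    D (lambda *: iota x + (1 - lambda) *: y) ->
    tikhonov iota F RU RW alpha beta v x y lambda
      <= tikhonov iota F RU RW alpha beta v (u lambda) (w lambda) lambda ->
    (0 < lambda -> x = u lambda) /\ (lambda < 1 -> y = w lambda).
  move=> /split01[->|->|/min_interior[[_ minl] uni]] Dxy.
  - rewrite !T0 => le0; split=> [|_]; first by rewrite ltxx.
    case: min0 => [[_ minl] uni]; apply/esym/uni; split.
      by move: Dxy; rewrite scale0r add0r subr0 scale1r.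
    by move=> y' Dy'; exact: le_trans le0 (minl _ Dy').
  - rewrite !T1 => le1; split=> [_|]; last by rewrite ltxx.
    case: min1 => [[_ minl] uni]; apply/esym/uni; split.
      by move: Dxy; rewrite subrr scale0r addr0 scale1r.
    by move=> x' Dx'; exact: le_trans le1 (minl _ Dx').
  - move=> lel; have [-> ->] // : (u lambda, w lambda) = (x, y).
    by apply: uni; split => // p Dp; exact: le_trans lel (minl _ Dp).
have key := minimizers_ultra_cvg hW hU D_closed D_convex F_strong hRW hRU
  iota_cont alpha_gt0 beta_gt0 feasible minimal uniq D_meets_U.
(* An ultrafilter refining the trace of the neighbourhoods on [A] converges to [lambda0] and
   contains [[0, 1]]. *)
have key_within (A : set R) (lambda0 : R) (H : set_system R) :
    A `<=` `[0, 1] -> A lambda0 -> UltraFilter H ->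
    within A (nbhs lambda0) `<=` H ->
    (0 < lambda0 -> u @ H --> u lambda0) /\ (lambda0 < 1 -> w @ H --> w lambda0).
  move=> A01 Al HU sub; have HP : ProperFilter H by exact: ultra_proper.
  apply: key => //.
  - by have := A01 _ Al; rewrite /= in_itv.
  - apply: (filterS A01); apply: sub; exact: withinT.
  - by move=> P lP; apply: sub; rewrite /within; apply: filterS lP.
split; apply/subspace_continuousP => l0 l0A; apply: ultra_cvg => H HU sub.
- apply: (key_within _ l0 H _ l0A HU sub).2.
    by move=> x; rewrite /= !in_itv/= => /andP[-> /ltW].
  by move: l0A; rewrite /= in_itv => /andP[].
- apply: (key_within _ l0 H _ l0A HU sub).1.
    by move=> x; rewrite /= !in_itv/= => /andP[/ltW ->].
  by move: l0A; rewrite /= in_itv => /andP[].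
Qed.
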